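(* $$16\sqrt2=\sum_{j=0}^{\infty}\left(-\frac14\right)^{j}\frac{\left(\frac18\right)_j\left(\frac58\right)_j\left(\frac34\right)_j}{(1)_j\left(\frac32\right)_j\left(\frac32\right)_j}\,(40j+23).$$
   Context: $(x)_0=1$ and $(x)_j=x(x+1)\cdots(x+j-1)$ for positive integers $j$ (rising factorial). *)

(* Defs.v *)
From Stdlib Require Import Reals.
From Coquelicot Require Import Coquelicot.
Open Scope R_scope.

(* Rising factorial (x)_j = x (x+1) ... (x+j-1), with (x)_0 = 1. *)
Fixpoint rising (x : R) (j : nat) : R :=
  match j with
  | O => 1
  | S k => rising x k * (x + INR k)
  end.

(* Main.v *)
Require Import Defs.
From Stdlib Require Import Reals Lra Lia.
From Coquelicot Require Import Coquelicot.
Open Scope R_scope.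

(** The series is embedded in a family with a free real parameter [a],
    [total a = sum_n summand a n], which at [a = 5/4] is the given series
    divided by [32].  The family is what one gets by accelerating,
    with summation by parts, the well-poised series
      [sum_k (-1)^k (a + 2k) (a)_k (3/4)_k^2 / (k! ((a + 1/4)_k)^2)],
    whose value is [Gamma(a + 1/4)^2 / (Gamma(a) Gamma(a - 1/2))].

    The proof does not go through that series or the Gamma function.  It uses
    that the summand has a Wilf-Zeilberger partner in the variables [a] and
    [n] (lemma [wz_pair]): with [rho = shift_factor a], the difference
    [summand (a + 1) n - rho * summand a n] telescopes in [n], and its
    boundary terms vanish at [n = 0] and at infinity, so that
    [total (a + 1) = rho * total a] (lemma [total_shift]).  Iterating from
    [5/4] expresses [total (5/4 + m)] as [total (5/4)] times a finite product.

    Both sides can be followed as [m] grows.  The terms after the first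
    have a bounded sum, so [total a = a + O(1)] (lemma [total_near]) and
    [total (5/4 + m) / (2m + 1)] tends to [1/2].  The product is
    [(2m + 1) w_m / w_(2m)], where [w_m] is a Wallis product growing like a
    constant times [sqrt m]; hence [w_(2m) / w_m] tends to [sqrt 2], whatever
    that constant is (lemma [is_lim_seq_wallis_double]).  Therefore
    [total (5/4) = sqrt 2 / 2], and [32 * sqrt 2 / 2 = 16 * sqrt 2]. *)

(** * A Wilf-Zeilberger family containing the series *)

Definition ratio (a : R) (n : nat) : R :=
  - ((3 / 4 + INR n) * (1 / 4 + INR n) * (a - 1 / 2 + INR n)
     * (1 / 4 + 2 * INR n) * (5 / 4 + 2 * INR n))
  / ((1 + 2 * INR n) * (2 + 2 * INR n) * (a + 1 / 4 + INR n)
     * (a + 1 / 4 + 2 * INR n) * (a + 5 / 4 + 2 * INR n)).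

(** This is
      [(-1)^n (3/4)_n (1/4)_n (a - 1/2)_n (1/4)_(2n)
       / ((a + 1/4)_n (a + 1/4)_(2n) (1)_(2n))];
    the recursive form makes the geometric decay and the behaviour under
    [a -> a + 1] immediate by induction. *)
Fixpoint hyp (a : R) (n : nat) : R :=
  match n with
  | O => 1
  | S k => hyp a k * ratio a k
  end.

(** The factor produced by the summation by parts; at [a = 5/4] it reduces to
    [(40 n + 23) (4 n + 1) / (32 (2 n + 1))]. *)
Definition weight (a : R) (n : nat) : R :=
  a + 2 * INR n
  - (3 / 4 + INR n) * (3 / 4 * a + 1 / 8 + 3 / 4 * INR n - 2 * INR n ^ 2)
    / ((a + 1 / 4 + 2 * INR n) * (1 + 2 * INR n)).

Definition summand (a : R) (n : nat) : R := hyp a n * weight a n.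

(** The quotient of the values of [Gamma(a + 1/4)^2 / (Gamma(a) Gamma(a - 1/2))]
    at [a + 1] and at [a]. *)
Definition shift_factor (a : R) : R := (a + 1 / 4) ^ 2 / (a * (a - 1 / 2)).

(** Each rising factorial that involves [a] changes by the rule
    [(x + 1)_n = (x)_n (x + n) / x]. *)
Lemma hyp_shift (a : R) (n : nat) :
  1 / 2 < a ->
  hyp (a + 1) n
  = hyp a n * ((a - 1 / 2 + INR n) * (a + 1 / 4) ^ 2
               / ((a - 1 / 2) * (a + 1 / 4 + INR n) * (a + 1 / 4 + 2 * INR n))).
Proof.
  intros Ha; induction n as [|n IH].
  - simpl; field; lra.
  - cbn [hyp]; rewrite IH; unfold ratio; rewrite S_INR.
    pose proof (pos_INR n) as Hn.
    field; repeat split; lra.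
Qed.

(** The certificate is [2 n * hyp a n].  After division by [hyp a n] the
    statement is an identity of rational functions in [a] and [n], by
    [hyp_shift] and the recurrence of [hyp]. *)
Lemma wz_pair (a : R) (n : nat) :
  1 / 2 < a ->
  summand (a + 1) n - shift_factor a * summand a n
  = shift_factor a * (2 * INR (S n) * hyp a (S n) - 2 * INR n * hyp a n).
Proof.
  intros Ha; unfold summand; rewrite hyp_shift by assumption.
  cbn [hyp]; unfold ratio, weight, shift_factor; rewrite S_INR.
  pose proof (pos_INR n) as Hn.
  field; repeat split; lra.
Qed.

Lemma sum_wz_pair (a : R) (N : nat) :
  1 / 2 < a ->
  sum_n (fun n => summand (a + 1) n - shift_factor a * summand a n) N
  = shift_factor a * (2 * INR (S N) * hyp a (S N)).
Proof.
  intros Ha; induction N as [|N IH].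
  - rewrite sum_O, wz_pair by assumption; simpl; ring.
  - rewrite sum_Sn.
    apply (eq_trans (A := R) (f_equal2 Rplus IH (wz_pair a (S N) Ha))); ring.
Qed.

(** * Estimates for the terms *)

(** The factors pair up into five quotients: two are at most [1/2], the other
    three at most [1]. *)
Lemma ratio_bound (a : R) (n : nat) : 1 <= a -> Rabs (ratio a n) <= 1 / 4.
Proof.
  intros Ha; pose proof (pos_INR n) as Hn; unfold ratio; set (x := INR n) in *.
  replace (- ((3 / 4 + x) * (1 / 4 + x) * (a - 1 / 2 + x) * (1 / 4 + 2 * x) * (5 / 4 + 2 * x))
     / ((1 + 2 * x) * (2 + 2 * x) * (a + 1 / 4 + x) * (a + 1 / 4 + 2 * x) * (a + 5 / 4 + 2 * x)))
   with (- (((3 / 4 + x) / (2 + 2 * x)) * ((1 / 4 + x) / (1 + 2 * x))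
      * ((a - 1 / 2 + x) / (a + 1 / 4 + x))
      * ((1 / 4 + 2 * x) / (a + 1 / 4 + 2 * x)) * ((5 / 4 + 2 * x) / (a + 5 / 4 + 2 * x))))
   by (field; repeat split; lra).
  assert (Hq : forall u v k, 0 <= u -> 0 < v -> u <= k * v -> 0 <= u / v <= k).
  { intros u v k Hu Hv Huv; split.
    - apply Rdiv_le_0_compat; assumption.
    - apply Rle_div_l; assumption. }
  assert (H1 := Hq (3 / 4 + x) (2 + 2 * x) (1 / 2) ltac:(lra) ltac:(lra) ltac:(lra)).
  assert (H2 := Hq (1 / 4 + x) (1 + 2 * x) (1 / 2) ltac:(lra) ltac:(lra) ltac:(lra)).
  assert (H3 := Hq (a - 1 / 2 + x) (a + 1 / 4 + x) 1 ltac:(lra) ltac:(lra) ltac:(lra)).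
  assert (H4 := Hq (1 / 4 + 2 * x) (a + 1 / 4 + 2 * x) 1 ltac:(lra) ltac:(lra) ltac:(lra)).
  assert (H5 := Hq (5 / 4 + 2 * x) (a + 5 / 4 + 2 * x) 1 ltac:(lra) ltac:(lra) ltac:(lra)).
  assert (Hm : forall u v k l, 0 <= u <= k -> 0 <= v <= l -> 0 <= u * v <= k * l).
  { intros u v k l Hu Hv; split.
    - apply Rmult_le_pos; lra.
    - apply Rmult_le_compat; lra. }
  pose proof (Hm _ _ _ _ (Hm _ _ _ _ (Hm _ _ _ _ (Hm _ _ _ _ H1 H2) H3) H4) H5) as H.
  rewrite Rabs_Ropp, Rabs_pos_eq; lra.
Qed.

Lemma hyp_bound (a : R) (n : nat) : 1 <= a -> Rabs (hyp a n) <= (1 / 4) ^ n.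
Proof.
  intros Ha; induction n as [|n IH]; cbn [hyp pow].
  - rewrite Rabs_R1; lra.
  - rewrite Rabs_mult, Rmult_comm.
    apply Rmult_le_compat; auto using Rabs_pos, ratio_bound.
Qed.

(** The first step gains at least a factor [1 / a], because the numerator of [ratio a 0]
    is of degree one in [a] and its denominator of degree three.  This gain
    cancels the growth of [weight a n] in [a], and makes the terms after the first
    bounded uniformly in [a]. *)
Lemma hyp_bound_tail (a : R) (n : nat) :
  1 <= a -> a * Rabs (hyp a (S n)) <= (1 / 4) ^ (S n).
Proof.
  intros Ha; induction n as [|n IH].
  - cbn [hyp pow]; unfold ratio; simpl INR.
    rewrite Rmult_1_l.
    replace (- ((3 / 4 + 0) * (1 / 4 + 0) * (a - 1 / 2 + 0) * (1 / 4 + 2 * 0) * (5 / 4 + 2 * 0))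
      / ((1 + 2 * 0) * (2 + 2 * 0) * (a + 1 / 4 + 0) * (a + 1 / 4 + 2 * 0) * (a + 5 / 4 + 2 * 0)))
      with (- (15 / 512 * (a - 1 / 2) * / ((a + 1 / 4) * ((a + 1 / 4) * (a + 5 / 4)))))
      by (field; lra).
    assert (Hd : 0 < (a + 1 / 4) * ((a + 1 / 4) * (a + 5 / 4)))
      by (repeat apply Rmult_lt_0_compat; lra).
    rewrite Rabs_Ropp, Rabs_pos_eq.
    2:{ apply Rdiv_le_0_compat; [nra | assumption]. }
    rewrite <- !Rmult_assoc.
    apply Rle_div_l; [rewrite Rmult_assoc; assumption | nra].
  - change (hyp a (S (S n))) with (hyp a (S n) * ratio a (S n)).
    change ((1 / 4) ^ S (S n)) with (1 / 4 * (1 / 4) ^ S n).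
    rewrite Rabs_mult.
    pose proof (ratio_bound a (S n) Ha).
    pose proof (Rabs_pos (hyp a (S n))); pose proof (Rabs_pos (ratio a (S n))).
    rewrite <- Rmult_assoc, (Rmult_comm (1 / 4)).
    apply Rmult_le_compat; nra.
Qed.

Lemma weight_bound (a : R) (n : nat) :
  1 <= a -> Rabs (weight a n) <= a * (3 * INR n + 2).
Proof.
  intros Ha; pose proof (pos_INR n) as Hn; unfold weight; set (x := INR n) in *.
  set (u := (3 / 4 + x) / (1 + 2 * x)).
  set (v := (3 / 4 * a + 1 / 8 + 3 / 4 * x - 2 * x ^ 2) / (a + 1 / 4 + 2 * x)).
  replace ((3 / 4 + x) * (3 / 4 * a + 1 / 8 + 3 / 4 * x - 2 * x ^ 2)
           / ((a + 1 / 4 + 2 * x) * (1 + 2 * x)))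
    with (u * v) by (unfold u, v; field; lra).
  assert (Hu : 0 <= u <= 1).
  { unfold u; split.
    - apply Rdiv_le_0_compat; lra.
    - apply Rle_div_l; lra. }
  assert (Hv : - (x + 1) <= v <= x + 1).
  { unfold v; split.
    - apply Rle_div_r; nra.
    - apply Rle_div_l; nra. }
  apply Rabs_le; nra.
Qed.

Lemma linear_le_pow2 (n : nat) : 3 * INR n + 2 <= 3 * 2 ^ n.
Proof.
  induction n as [|n IH]; [simpl; lra | rewrite S_INR; cbn [pow]].
  destruct n as [|n]; [simpl; lra | rewrite S_INR in *].
  pose proof (pos_INR n); lra.
Qed.

Lemma pow_quarter_mult (n : nat) : (1 / 4) ^ n * 2 ^ n = (1 / 2) ^ n.
Proof. rewrite <- Rpow_mult_distr; f_equal; lra. Qed.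

Lemma summand_bound (a : R) (n : nat) :
  1 <= a -> Rabs (summand a n) <= 3 * a * (1 / 2) ^ n.
Proof.
  intros Ha; unfold summand; rewrite Rabs_mult, <- pow_quarter_mult.
  replace (3 * a * ((1 / 4) ^ n * 2 ^ n)) with ((1 / 4) ^ n * (a * (3 * 2 ^ n))) by ring.
  apply Rmult_le_compat; auto using Rabs_pos, hyp_bound.
  eapply Rle_trans; [apply weight_bound; assumption|].
  apply Rmult_le_compat_l; [lra | apply linear_le_pow2].
Qed.

Lemma summand_bound_tail (a : R) (n : nat) :
  1 <= a -> Rabs (summand a (S n)) <= 3 / 2 * (1 / 2) ^ n.
Proof.
  intros Ha; unfold summand; rewrite Rabs_mult.
  replace (3 / 2 * (1 / 2) ^ n) with (3 * ((1 / 4) ^ S n * 2 ^ S n))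
    by (rewrite pow_quarter_mult; cbn [pow]; lra).
  apply Rle_trans with (Rabs (hyp a (S n)) * (a * (3 * 2 ^ S n))).
  - apply Rmult_le_compat_l; [apply Rabs_pos|].
    eapply Rle_trans; [apply weight_bound; assumption|].
    apply Rmult_le_compat_l; [lra | apply linear_le_pow2].
  - replace (Rabs (hyp a (S n)) * (a * (3 * 2 ^ S n)))
      with (3 * (a * Rabs (hyp a (S n)) * 2 ^ S n)) by ring.
    apply Rmult_le_compat_l; [lra|].
    apply Rmult_le_compat_r; [apply pow_le; lra | apply hyp_bound_tail; assumption].
Qed.

Lemma is_series_half (c : R) : is_series (fun n => c * (1 / 2) ^ n) (c * 2).
Proof.
  assert (H : is_series (fun n => (1 / 2) ^ n) (/ (1 - 1 / 2)))
    by (apply is_series_geom; rewrite Rabs_pos_eq; lra).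
  replace (/ (1 - 1 / 2)) with 2 in H by field.
  exact (is_series_scal c _ _ H).
Qed.

Lemma ex_series_summand (a : R) : 1 <= a -> ex_series (summand a).
Proof.
  intros Ha; apply (ex_series_le (K := R_AbsRing) (V := R_CompleteNormedModule))
    with (b := fun n => 3 * a * (1 / 2) ^ n).
  - intros n; apply summand_bound; assumption.
  - exists (3 * a * 2); apply is_series_half.
Qed.

Definition total (a : R) : R := Series (summand a).

(** * Dependence of the sum on the parameter *)

Lemma is_lim_seq_wz_boundary (a : R) :
  1 <= a -> is_lim_seq (fun n => 2 * INR (S n) * hyp a (S n)) 0.
Proof.
  intros Ha; apply is_lim_seq_abs_0.
  apply is_lim_seq_le_le with (u := fun _ => 0) (w := fun n => 1 * (1 / 2) ^ n).
  - intros n; split; [apply Rabs_pos|].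
    rewrite Rabs_mult, (Rabs_pos_eq (2 * INR (S n)))
      by (pose proof (pos_INR (S n)); lra).
    replace (1 * (1 / 2) ^ n) with (2 * 2 ^ S n * (1 / 4) ^ S n)
      by (rewrite Rmult_assoc, (Rmult_comm (2 ^ S n)), pow_quarter_mult; cbn [pow]; lra).
    apply Rmult_le_compat; auto using Rabs_pos, hyp_bound.
    + pose proof (pos_INR (S n)); lra.
    + pose proof (linear_le_pow2 (S n)); lra.
  - apply is_lim_seq_const.
  - replace (Finite 0) with (Rbar_mult 1 0) by (simpl; f_equal; ring).
    apply is_lim_seq_scal_l, is_lim_seq_geom; rewrite Rabs_pos_eq; lra.
Qed.

Lemma total_shift (a : R) : 1 <= a -> total (a + 1) = shift_factor a * total a.
Proof.
  intros Ha; unfold total.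
  assert (H1 := ex_series_summand a Ha).
  assert (H2 := ex_series_summand (a + 1) ltac:(lra)).
  apply Rminus_diag_uniq; rewrite <- Series_scal_l, <- Series_minus; trivial.
  2:{ exact (ex_series_scal (shift_factor a) _ H1). }
  apply is_series_unique.
  change (is_lim_seq (sum_n (fun n => summand (a + 1) n - shift_factor a * summand a n)) 0).
  apply (is_lim_seq_ext (fun N => shift_factor a * (2 * INR (S N) * hyp a (S N)))).
  - intros N; symmetry; apply sum_wz_pair; lra.
  - replace (Finite 0) with (Rbar_mult (shift_factor a) 0) by (simpl; f_equal; ring).
    apply is_lim_seq_scal_l, is_lim_seq_wz_boundary; assumption.
Qed.

(** The first term is [a] up to an error below [1], and the other terms add up
    to at most [3] by [summand_bound_tail]. *)
Lemma total_near (a : R) : 1 <= a -> Rabs (total a - a) <= 4.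
Proof.
  intros Ha; unfold total.
  rewrite Series_incr_1 by (apply ex_series_summand; assumption).
  assert (Htail : Rabs (Series (fun n => summand a (S n))) <= 3).
  { eapply Rle_trans; [apply Series_Rabs|].
    - apply (ex_series_le (K := R_AbsRing) (V := R_CompleteNormedModule))
        with (b := fun n => 3 / 2 * (1 / 2) ^ n).
      + intros n; change (norm (Rabs (summand a (S n)))) with (Rabs (Rabs (summand a (S n)))).
        rewrite Rabs_Rabsolu; apply summand_bound_tail; assumption.
      + exists (3 / 2 * 2); apply is_series_half.
    - apply Rle_trans with (Series (fun n => 3 / 2 * (1 / 2) ^ n)).
      2:{ rewrite (is_series_unique _ _ (is_series_half (3 / 2))); lra. }
      apply Series_le.
      + intros n; split; [apply Rabs_pos | apply summand_bound_tail; assumption].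
      + exists (3 / 2 * 2); apply is_series_half. }
  assert (Hhead : Rabs (summand a 0 - a) <= 1).
  { unfold summand, weight; simpl.
    replace (1 * (a + 2 * 0 - (3 / 4 + 0) * (3 / 4 * a + 1 / 8 + 3 / 4 * 0 - 2 * (0 * (0 * 1)))
               / ((a + 1 / 4 + 2 * 0) * (1 + 2 * 0))) - a)
      with (- ((9 / 16 * a + 3 / 32) / (a + 1 / 4))) by (field; lra).
    rewrite Rabs_Ropp, Rabs_pos_eq.
    - apply Rle_div_l; lra.
    - apply Rdiv_le_0_compat; lra. }
  replace (summand a 0 + Series (fun n => summand a (S n)) - a)
    with ((summand a 0 - a) + Series (fun n => summand a (S n))) by ring.
  eapply Rle_trans; [apply Rabs_triang | lra].
Qed.

(** * A Wallis product *)

Fixpoint wallis (m : nat) : R :=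
  match m with
  | O => 1
  | S k => wallis k * ((2 * INR k + 3) / (2 * INR k + 2))
  end.

Lemma wallis_pos (m : nat) : 0 < wallis m.
Proof.
  induction m as [|m IH]; simpl wallis; [lra|].
  pose proof (pos_INR m); apply Rmult_lt_0_compat; [assumption|].
  apply Rdiv_lt_0_compat; lra.
Qed.

(** [w_m^2 / (m + 1)] increases, while [w_m^2 / (2m + 1)] decreases (next
    lemma); together they pin down [w_(2m)^2 / w_m^2] without the asymptotic
    constant of [w_m].  The variable [j] turns monotonicity into a comparison
    of two distant indices. *)
Lemma wallis_lower (m j : nat) :
  wallis m ^ 2 / (INR m + 1) <= wallis (j + m) ^ 2 / (INR (j + m) + 1).
Proof.
  induction j as [|j IH]; [apply Rle_refl|].
  eapply Rle_trans; [exact IH|].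
  cbn [Nat.add wallis]; rewrite S_INR; set (x := INR (j + m)).
  assert (Hx : 0 <= x) by apply pos_INR.
  apply Rminus_le_0.
  replace ((wallis (j + m) * ((2 * x + 3) / (2 * x + 2))) ^ 2 / (x + 1 + 1)
           - wallis (j + m) ^ 2 / (x + 1))
    with (wallis (j + m) ^ 2 / ((2 * x + 2) ^ 2 * (x + 2))) by (field; lra).
  apply Rdiv_le_0_compat; [apply pow2_ge_0 | nra].
Qed.

Lemma wallis_upper (m j : nat) :
  wallis (j + m) ^ 2 / (2 * INR (j + m) + 1) <= wallis m ^ 2 / (2 * INR m + 1).
Proof.
  induction j as [|j IH]; [apply Rle_refl|].
  eapply Rle_trans; [|exact IH].
  cbn [Nat.add wallis]; rewrite S_INR; set (x := INR (j + m)).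
  assert (Hx : 0 <= x) by apply pos_INR.
  apply Rminus_le_0.
  replace (wallis (j + m) ^ 2 / (2 * x + 1)
           - (wallis (j + m) * ((2 * x + 3) / (2 * x + 2))) ^ 2 / (2 * (x + 1) + 1))
    with (wallis (j + m) ^ 2 / ((2 * x + 2) ^ 2 * (2 * x + 1))) by (field; lra).
  apply Rdiv_le_0_compat; [apply pow2_ge_0 | nra].
Qed.

Lemma is_lim_seq_inv_succ (c : R) : is_lim_seq (fun m => c / (2 * INR m + 1)) 0.
Proof.
  apply is_lim_seq_ext with (fun m => c * / (2 * INR m + 1)); [reflexivity|].
  replace (Finite 0) with (Rbar_mult c 0) by (simpl; f_equal; ring).
  apply is_lim_seq_scal_l.
  apply is_lim_seq_le_le with (u := fun _ => 0) (w := fun m => / INR (S m)).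
  - intros m; rewrite S_INR; pose proof (pos_INR m); split.
    + left; apply Rinv_0_lt_compat; lra.
    + apply Rinv_le_contravar; lra.
  - apply is_lim_seq_const.
  - apply (is_lim_seq_incr_1 (fun m => / INR m)).
    replace (Finite 0) with (Rbar_inv p_infty) by reflexivity.
    apply is_lim_seq_inv; [apply is_lim_seq_INR | discriminate].
Qed.

(** The two monotonicities give
    [(2m + 1) / (m + 1) <= w_(2m)^2 / w_m^2 <= (4m + 1) / (2m + 1)]. *)
Lemma is_lim_seq_wallis_double :
  is_lim_seq (fun m => wallis (m + m) / wallis m) (sqrt 2).
Proof.
  apply is_lim_seq_ext with (fun m => sqrt ((wallis (m + m) / wallis m) ^ 2)).
  { intros m; apply sqrt_pow2; left.
    apply Rdiv_lt_0_compat; apply wallis_pos. }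
  apply is_lim_seq_continuous; [apply continuity_pt_sqrt; lra|].
  apply is_lim_seq_le_le
    with (u := fun m => 2 - 2 / (2 * INR m + 1)) (w := fun m => 2 - 1 / (2 * INR m + 1)).
  - intros m; pose proof (pos_INR m) as Hm.
    pose proof (wallis_lower m m) as Hl; pose proof (wallis_upper m m) as Hu.
    rewrite plus_INR in *.
    pose proof (wallis_pos m) as Hp.
    assert (Hp2 : 0 < wallis m ^ 2) by (apply pow_lt; assumption).
    replace ((wallis (m + m) / wallis m) ^ 2) with (wallis (m + m) ^ 2 / wallis m ^ 2)
      by (field; lra).
    split.
    + apply Rle_trans with ((INR m + INR m + 1) / (INR m + 1)).
      * apply Rminus_le_0.
        replace ((INR m + INR m + 1) / (INR m + 1) - (2 - 2 / (2 * INR m + 1)))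
          with (1 / ((INR m + 1) * (2 * INR m + 1))) by (field; lra).
        apply Rdiv_le_0_compat; nra.
      * apply (Rle_div_r _ _ _ Hp2).
        apply (Rle_div_r _ _ (INR m + INR m + 1)) in Hl; [|lra].
        eapply Rle_trans; [|exact Hl]; right; field; lra.
    + apply (Rle_div_l _ _ _ Hp2).
      apply (Rle_div_l _ _ (2 * (INR m + INR m) + 1)) in Hu; [|lra].
      eapply Rle_trans; [exact Hu|]; right; field; lra.
  - replace (Finite 2) with (Finite (2 - 0)) by (f_equal; ring).
    apply is_lim_seq_minus'; [apply is_lim_seq_const | apply is_lim_seq_inv_succ].
  - replace (Finite 2) with (Finite (2 - 0)) by (f_equal; ring).
    apply is_lim_seq_minus'; [apply is_lim_seq_const | apply is_lim_seq_inv_succ].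
Qed.

(** * Evaluation *)

(** For [a = 5/4 + m] the factor [shift_factor a] is
    [(4m + 6)^2 / ((4m + 3) (4m + 5))].  The two factors in the denominator
    are the odd numbers that appear in the Wallis product when its length
    grows from [2m] to [2m + 2]. *)
Lemma total_iterate (m : nat) :
  total (5 / 4 + INR m) = total (5 / 4) * ((2 * INR m + 1) * wallis m / wallis (m + m)).
Proof.
  induction m as [|m IH].
  - simpl; rewrite Rplus_0_r; field.
  - pose proof (pos_INR m) as Hm; pose proof (wallis_pos m); pose proof (wallis_pos (m + m)).
    rewrite S_INR, <- Rplus_assoc, total_shift, IH by lra.
    replace (S m + S m)%nat with (S (S (m + m))) by lia.
    cbn [wallis]; rewrite !S_INR, plus_INR; unfold shift_factor.
    field; repeat split; lra.
Qed.

(** By [total_iterate], [total (5/4)] is for every [m] the product of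
    [total (5/4 + m) / (2m + 1)], which tends to [1/2], and
    [wallis (m + m) / wallis m]. *)
Lemma total_value : total (5 / 4) = sqrt 2 / 2.
Proof.
  assert (Hlim : is_lim_seq (fun m => total (5 / 4 + INR m) / (2 * INR m + 1)) (1 / 2)).
  { apply is_lim_seq_le_le
      with (u := fun m => 1 / 2 - 5 / (2 * INR m + 1))
           (w := fun m => 1 / 2 + 5 / (2 * INR m + 1)).
    - intros m; pose proof (pos_INR m) as Hm.
      pose proof (total_near (5 / 4 + INR m) ltac:(lra)) as Ht.
      apply Rabs_le_between in Ht; split.
      + apply Rle_div_r; [lra|].
        replace ((1 / 2 - 5 / (2 * INR m + 1)) * (2 * INR m + 1))
          with (INR m + 1 / 2 - 5) by (field; lra).
        lra.
      + apply Rle_div_l; [lra|].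
        replace ((1 / 2 + 5 / (2 * INR m + 1)) * (2 * INR m + 1))
          with (INR m + 1 / 2 + 5) by (field; lra).
        lra.
    - replace (Finite (1 / 2)) with (Finite (1 / 2 - 0)) by (f_equal; ring).
      apply is_lim_seq_minus'; [apply is_lim_seq_const | apply is_lim_seq_inv_succ].
    - replace (Finite (1 / 2)) with (Finite (1 / 2 + 0)) by (f_equal; ring).
      apply is_lim_seq_plus'; [apply is_lim_seq_const | apply is_lim_seq_inv_succ]. }
  pose proof (is_lim_seq_mult' _ _ _ _ Hlim is_lim_seq_wallis_double) as H.
  apply is_lim_seq_ext with (v := fun _ => total (5 / 4)) in H.
  - apply is_lim_seq_unique in H; rewrite Lim_seq_const in H.
    injection H as H; lra.
  - intros m; rewrite total_iterate.
    pose proof (pos_INR m); pose proof (wallis_pos m); pose proof (wallis_pos (m + m)).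
    field; repeat split; lra.
Qed.

Lemma rising_pos (x : R) (n : nat) : 0 < x -> 0 < rising x n.
Proof.
  intros Hx; induction n as [|n IH]; simpl rising; [lra|].
  pose proof (pos_INR n); apply Rmult_lt_0_compat; [assumption | lra].
Qed.

(** At [a = 5/4] the two factorials [(a + 1/4)_n] and [(a + 1/4)_(2n)] start
    at [3/2]; by the duplication formula everything cancels against the stated
    quotient except [(1/4)_n / (5/4)_n = 1 / (4n + 1)] and
    [(3/2)_n / (1/2)_n = 2n + 1]. *)
Lemma hyp_five_quarters (n : nat) :
  (- (1 / 4)) ^ n
  * ((rising (1 / 8) n * rising (5 / 8) n * rising (3 / 4) n)
     / (rising 1 n * rising (3 / 2) n * rising (3 / 2) n))
  = hyp (5 / 4) n * ((4 * INR n + 1) / (2 * INR n + 1)).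
Proof.
  induction n as [|n IH]; [simpl; field|].
  pose proof (pos_INR n) as Hn.
  pose proof (rising_pos 1 n ltac:(lra)); pose proof (rising_pos (3 / 2) n ltac:(lra)).
  cbn [rising hyp pow]; rewrite S_INR; set (x := INR n) in *.
  transitivity
    ((- (1 / 4)) ^ n
     * ((rising (1 / 8) n * rising (5 / 8) n * rising (3 / 4) n)
        / (rising 1 n * rising (3 / 2) n * rising (3 / 2) n))
     * (- (1 / 4) * ((1 / 8 + x) * (5 / 8 + x) * (3 / 4 + x))
        / ((1 + x) * (3 / 2 + x) * (3 / 2 + x)))).
  - field; repeat split; lra.
  - rewrite IH; unfold ratio; fold x; field; repeat split; lra.
Qed.

Lemma summand_five_quarters (n : nat) :
  32 * summand (5 / 4) n
  = (- (1 / 4)) ^ n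
    * ((rising (1 / 8) n * rising (5 / 8) n * rising (3 / 4) n)
       / (rising 1 n * rising (3 / 2) n * rising (3 / 2) n))
    * (40 * INR n + 23).
Proof.
  rewrite hyp_five_quarters; unfold summand, weight.
  pose proof (pos_INR n); field; repeat split; lra.
Qed.

Theorem mainTheorem7 :
  is_series
    (fun j : nat =>
       (- (1 / 4)) ^ j
       * ((rising (1 / 8) j * rising (5 / 8) j * rising (3 / 4) j)
          / (rising 1 j * rising (3 / 2) j * rising (3 / 2) j))
       * (40 * INR j + 23))
    (16 * sqrt 2).
Proof.
  apply is_series_ext with (fun j => 32 * summand (5 / 4) j).
  - exact summand_five_quarters.
  - replace (16 * sqrt 2) with (32 * total (5 / 4)) by (rewrite total_value; field).
    apply (is_series_scal (V := R_NormedModule) 32 (summand (5 / 4)) (total (5 / 4))).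
    apply Series_correct, ex_series_summand; lra.
Qed.
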